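(* Let $G$ be a distribution function on $(0,\infty)$. Let $\phi_1$ and $\phi_2$ be two bounded real valued functions on $(0,\infty)$ and $\theta\in\mathbb{R}$ such that: (1) $\phi_1$ takes both positive and negative values; (2) $\lim_{x\to\infty}\phi_1(x)=d_1\in\mathbb{R}$ exists; (3) for all $x>0$, $y>0$, $1+\theta\phi_1(x)\phi_2(y)\ge0$; (4) $\int_0^\infty\phi_2(y)\,G(dy)=0$. For some $\alpha>0$, $\epsilon>0$ and $\beta_0\in\mathbb{R}$, assume that $\int_0^\infty y^{\alpha+\epsilon}\,G(dy)<\infty$ and $$\int_0^\infty y^{\alpha+i\beta_0}\,G(dy)+\theta d_1\int_0^\infty\phi_2(y)y^{\alpha+i\beta_0}\,G(dy)=0.$$ If $Y\sim G$, then there exists a random variable $X$, whose tail is not regularly varying, such that $(X,Y)$ is jointly distributed as bivariate Sarmanov with kernel functions $\phi_1,\phi_2$ and constant $\theta$, and such that $XY$ has a regularly varying tail with index $-\alpha$.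
   Context: Notation: for a distribution function $F$, $\overline{F}(x)=1-F(x)$. For positive functions, $a(x)\sim b(x)$ as $x\to\infty$ means $\lim_{x\to\infty}a(x)/b(x)=1$. Bivariate Sarmanov distribution: $(X,Y)$ follows a bivariate Sarmanov distribution with marginals $F$ (of $X$) and $G$ (of $Y$), kernels $\phi_1,\phi_2$ and parameter (constant) $\theta$ if $$P(X\in dx,Y\in dy)=(1+\theta\phi_1(x)\phi_2(y))F(dx)G(dy),\quad x\in\mathbb{R},\ y\ge 0,$$ where $\phi_1,\phi_2$ are real valued functions and $\theta$ is a real constant satisfying $E\{\phi_1(X)\}=E\{\phi_2(Y)\}=0$ and $1+\theta\phi_1(x)\phi_2(y)\ge 0$ for all $x\in D_X$, $y\in D_Y$; here $D_X\subset\mathbb{R}$ and $D_Y\subset\mathbb{R}^+$ are the supports of $X$ and $Y$. Regular variation: a random variable $X$ with tail $\overline F(x)=P[X>x]$ has a regularly varying tail of index $-\alpha$, $\alpha>0$, if for all $y>0$, $\overline{F}(xy)\sim y^{-\alpha}\overline{F}(x)$ as $x\to\infty$. *)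

(* Defs.v *)
From HB Require Import structures.
From mathcomp Require Import all_boot all_order all_algebra.
From mathcomp Require Import all_classical all_reals all_analysis.
From mathcomp Require Import complex.

Set Implicit Arguments.
Unset Strict Implicit.
Unset Printing Implicit Defensive.

Import Order.TTheory GRing.Theory Num.Theory.
Import numFieldNormedType.Exports.

Local Open Scope classical_set_scope.
Local Open Scope ring_scope.

Definition posR (R : realType) : set R := `]0, +oo[%classic.
Arguments posR R : clear implicits.

(* [a / b] is total, with value 0 where [b] vanishes: [asymp_equiv a b] forces
   [a] and [b] to be nonzero near +oo. *)
Definition asymp_equiv (R : realType) (a b : R -> R) : Prop :=
  a x / b x @[x --> +oo] --> (1 : R).

Definition tail d (T : measurableType d) (R : realType) (P : probability T R)
    (X : T -> R) (x : R) : R :=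
  fine (P [set w | x < X w]).

Definition regularly_varying_tail d (T : measurableType d) (R : realType)
    (P : probability T R) (X : T -> R) (alpha : R) : Prop :=
  0 < alpha /\
  forall y, 0 < y ->
    asymp_equiv (fun x => tail P X (x * y))
      (fun x => y `^ (- alpha) * tail P X x).

(* The topological support of [mu] within the state space [E], e.g. 0 is not in
   the support of a law on (0, +oo). *)
Definition law_support (R : realType) (E : set R)
    (mu : {measure set R -> \bar R}) : set R :=
  [set x | E x /\ forall U : set R, open U -> U x -> (0 < mu U)%E].

(* [X] and [Y] almost surely lie in [E1] and [E2], on which the kernels are
   defined; the values of the total functions [phi1], [phi2] outside [E1], [E2]
   are never used. The penultimate clause is the density formula
   P(X in dx, Y in dy) = (1 + theta phi1(x) phi2(y)) F(dx) G(dy). *)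
Definition bivariate_sarmanov d (T : measurableType d) (R : realType)
    (P : probability T R) (X Y : {RV P >-> R}) (E1 E2 : set R)
    (phi1 phi2 : R -> R) (theta : R) : Prop :=
  let F : probability R R := distribution P X in
  let G : probability R R := distribution P Y in
  [/\ F E1 = 1%E /\ G E2 = 1%E,
      F.-integrable E1 (EFin \o phi1) /\ (\int[F]_(x in E1) (phi1 x)%:E = 0)%E,
      G.-integrable E2 (EFin \o phi2) /\ (\int[G]_(y in E2) (phi2 y)%:E = 0)%E,
      forall C : set (R * R), measurable C ->
        P [set w | C (X w, Y w)] =
        (\int[F \x G]_(z in C `&` (E1 `*` E2))
            (1 + theta * phi1 z.1 * phi2 z.2)%:E)%E &
      forall x y, law_support E1 F x -> law_support E2 G y ->
        0 <= 1 + theta * phi1 x * phi2 y].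

(* The complex power y ^ z for real y > 0. *)
Definition cpow (R : realType) (y : R) (z : R[i]) : R[i] :=
  let: (a +i* b)%C := z in
  ((y `^ a * cos (b * ln y)) +i* (y `^ a * sin (b * ln y)))%C.

Definition cintegral d (T : measurableType d) (R : realType)
    (mu : {measure set T -> \bar R}) (D : set T) (f : T -> R[i]) : R[i] :=
  ((\int[mu]_(x in D) complex.Re (f x)) +i*
   (\int[mu]_(x in D) complex.Im (f x)))%C.

(* Main.v *)
(** Take [X] with tail [p t^-alpha (1 + b sin (be ln t))] for large [t], where
    [be = |beta0|] and [b] is small enough for this to decrease, plus an atom
    chosen so that [E phi1(X) = 0]; the oscillation prevents regular variation.
    Conditioning on [Y = y], dominated convergence shows that [x^alpha P(XY > x)]
    is asymptotic to
    [p * int y^alpha (1 + theta d1 phi2(y)) (1 + b sin (be (ln x - ln y))) G(dy)],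
    and the Mellin condition kills the oscillating part. What remains is [p m]
    with [m = int y^alpha (1 + theta d1 phi2(y)) G(dy)], positive because
    [1 + theta d1 phi2] is nonnegative with [G]-mean 1; for the same reason the
    Mellin condition forces [beta0 <> 0]. *)

Require Import Defs.
From HB Require Import structures.
From mathcomp Require Import all_boot all_order all_algebra.
From mathcomp Require Import all_classical all_reals all_analysis.
From mathcomp Require Import complex measurable_realfun.
From mathcomp Require Import ring lra.

Set Implicit Arguments.
Unset Strict Implicit.
Unset Printing Implicit Defensive.

Import Order.TTheory GRing.Theory Num.Theory.
Import numFieldNormedType.Exports.

Local Open Scope classical_set_scope.
Local Open Scope ring_scope.

(** * A law with log-periodically oscillating tail *)

Lemma sin_sub_le (R : realType) (x y : R) : `|sin y - sin x| <= `|y - x|.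
Proof.
wlog xy : x y / x <= y => [h|].
  by have [/h//|/ltW/h] := leP x y; rewrite distrC (distrC x).
have sinD z : z \in `]x, y[ -> is_derive z 1 sin (cos z).
  by move=> _; exact: is_derive_sin.
have [|c _ ->] := MVT_segment xy sinD.
  by apply: continuous_subspaceT => z; exact: continuous_sin.
by rewrite normrM ler_piMl// ler_norml cos_geN1 cos_le1.
Qed.

(* The largest [b] with [b * |be| <= al * (1 - b)]: by [osc_le], this makes
   [t `^ (- al) * (1 + b * sin (be * ln t))] nonincreasing. *)
Definition osc_coef (R : realType) (al be : R) : R := al / (al + `|be|).

Definition osc (R : realType) (al be s : R) : R :=
  1 + osc_coef al be * sin (be * s).

Section oscillating_law.
Context {R : realType} (al be : R).
Hypothesis al0 : 0 < al.

Let b := osc_coef al be.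

Lemma osc_coef_gt0 : 0 < b.
Proof. by rewrite divr_gt0// ltr_pwDl. Qed.

Lemma osc_coef_le1 : b <= 1.
Proof. by rewrite ler_pdivrMr ?ltr_pwDl// mul1r lerDl. Qed.

Lemma osc_ge s : 1 - b <= osc al be s.
Proof.
rewrite lerD2l -/b -[leLHS]mulrN1.
by rewrite ler_wpM2l ?sin_geN1// ltW// osc_coef_gt0.
Qed.

Lemma osc_ge0 s : 0 <= osc al be s.
Proof. by rewrite (le_trans _ (osc_ge s))// subr_ge0 osc_coef_le1. Qed.

Lemma osc_le2 s : osc al be s <= 2.
Proof.
rewrite -[leRHS]/(1 + 1) lerD2l -/b (le_trans _ osc_coef_le1)// ler_piMr ?sin_le1//.
by rewrite ltW// osc_coef_gt0.
Qed.

(** The choice of [osc_coef] gives [b * |be| = al * (1 - b)]. Since [sin] is 1-Lipschitz, [osc]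
    grows over [[s, t]] by at most [al * (1 - b) * (t - s)]; as [1 - b <= osc al be s], this is at
    most a factor [1 + al * (t - s)]. *)
Lemma osc_le s t : s <= t -> osc al be t <= osc al be s * expR (al * (t - s)).
Proof.
move=> st.
have ts0 : 0 <= t - s by rewrite subr_ge0.
have bbe : b * `|be| = al * (1 - b).
  by rewrite /b /osc_coef; field; rewrite lt0r_neq0// ltr_pwDl.
have h1 : osc al be t <= osc al be s + al * (1 - b) * (t - s).
  rewrite /osc -/b -bbe -addrA lerD2l -lerBlDl -mulrBr -mulrA.
  apply: ler_wpM2l; first exact/ltW/osc_coef_gt0.
  rewrite (le_trans (ler_norm _))// (le_trans (sin_sub_le _ _))//.
  by rewrite -mulrBr normrM (ger0_norm ts0).
apply: (le_trans h1); rewrite (@le_trans _ _ (osc al be s * (1 + al * (t - s))))//.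
  rewrite [leRHS]mulrDr mulr1 lerD2l [leRHS]mulrCA -mulrA.
  apply: ler_wpM2l; first exact: ltW.
  by apply: ler_wpM2r => //; exact: osc_ge.
by apply: ler_wpM2l; [exact: osc_ge0|exact: expR_ge1Dx].
Qed.

(** The intended tail at [t = expR s]; in this variable its monotonicity is the inequality
    [osc_le]. *)
Let surv s := expR (- al * s) * osc al be s.

Let surv0 : surv 0 = 1.
Proof. by rewrite /surv /osc !mulr0 expR0 sin0 mulr0 addr0 mulr1. Qed.

Let surv_ge0 s : 0 <= surv s.
Proof. by rewrite mulr_ge0 ?expR_ge0 ?osc_ge0. Qed.

Let surv_ni s t : s <= t -> surv t <= surv s.
Proof.
move=> st; rewrite /surv (le_trans (ler_wpM2l (expR_ge0 _) (osc_le st)))//.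
rewrite mulrCA -expRD mulrC (_ : - al * t + al * (t - s) = - al * s)//; ring.
Qed.

Let surv_continuous : continuous surv.
Proof.
move=> s; apply: cvgM.
  apply: continuous_comp; last exact: continuous_expR.
  by apply: cvgM; [exact: cvg_cst|exact: cvg_id].
apply: cvgD; first exact: cvg_cst.
apply: cvgM; first exact: cvg_cst.
apply: continuous_comp; last exact: continuous_sin.
by apply: cvgM; [exact: cvg_cst|exact: cvg_id].
Qed.

Let surv_cvg0 : surv (ln x) @[x --> +oo] --> 0.
Proof.
have -> : (0 : R) = 0 * 2 by rewrite mul0r.
apply: (@squeeze_cvgr _ _ _ _ (cst 0) (fun x => expR (- al * ln x) * 2)).
- near=> x; rewrite surv_ge0/=.
  by apply: ler_wpM2l; [exact: expR_ge0|exact: osc_le2].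
- by rewrite mul0r; exact: cvg_cst.
- apply: cvgM; last exact: cvg_cst.
  under eq_cvg do rewrite mulNr.
  apply: (@cvg_comp _ _ _ (fun x => al * ln x) (fun x => expR (- x)) _ (+oo));
    last exact: cvgr_expR.
  apply/cvgryPge => M; near=> x.
  rewrite mulrC -ler_pdivrMr// -ler_expR lnK ?posrE.
    by near: x; exact: nbhs_pinfty_ge.
  by near: x; exact: nbhs_pinfty_gt.
Unshelve. all: by end_near. Qed.

(** The truncation at 1 makes this 0 for [x <= 1]; since [surv 0 = 1], there is no jump at 1. *)
Let osc_cdf x := 1 - surv (ln (Order.max x 1)).

Let max1_gt0 (x : R) : 0 < Order.max x 1.
Proof. by rewrite lt_max ltr01 orbT. Qed.

Let osc_cdf_nd : nondecreasing osc_cdf.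
Proof.
move=> x y xy; rewrite lerB//; apply: surv_ni.
rewrite ler_ln ?posrE ?max1_gt0//.
by rewrite ge_max le_max xy/= le_max lexx orbT.
Qed.

Let osc_cdf_rc : right_continuous osc_cdf.
Proof.
move=> x; apply: cvg_within_filter => //.
apply: cvgB; first exact: cvg_cst.
have cm : {for x, continuous (fun x : R => Order.max x 1)}.
  exact: (continuous_max (@cvg_id _ _) (cvg_cst _)).
have cl : {for x, continuous (@ln R \o (fun x : R => Order.max x 1))}.
  by apply: continuous_comp => //; exact/continuous_ln/max1_gt0.
have : {for x, continuous (surv \o (@ln R \o (fun x : R => Order.max x 1)))}.
  by apply: continuous_comp => //; exact: surv_continuous.
exact.
Qed.

HB.instance Definition _ := isCumulative.Build R _ R osc_cdf osc_cdf_nd osc_cdf_rc.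

Let osc_cdfNy : osc_cdf x @[x --> -oo] --> (0 : R).
Proof.
apply: cvg_near_cst; near=> x.
rewrite /osc_cdf max_r; last by near: x; exact: nbhs_ninfty_le.
by rewrite ln1 surv0 subrr.
Unshelve. all: by end_near. Qed.

Let osc_cdfy : osc_cdf x @[x --> +oo] --> (1 : R).
Proof.
rewrite -[X in _ --> X]subr0 /osc_cdf; apply: cvgB; first exact: cvg_cst.
apply: cvg_trans surv_cvg0; apply: near_eq_cvg; near=> x.
by rewrite max_l//; near: x; exact: nbhs_pinfty_ge.
Unshelve. all: by end_near. Qed.

HB.instance Definition _ := isCumulativeBounded.Build R 0 1 osc_cdf osc_cdfNy osc_cdfy.

Lemma oscillating_law : exists mu : probability R R, forall t, 1 <= t ->
  mu `]t, +oo[%classic = (t `^ (- al) * osc al be (ln t))%:E.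
Proof.
(* Seen as a random variable, the identity has the Lebesgue-Stieltjes measure of [osc_cdf] as its
   law, so its tail is one minus a known distribution function. *)
pose idTR : measurableTypeR R -> R := idfun.
pose mI := @isMeasurableFun.Build _ _ _ _ idTR (@measurable_id _ _ setT).
pose I : {mfun _ >-> _} := HB.pack idTR mI.
exists (distribution (lebesgue_stieltjes_measure osc_cdf) I) => t t1.
have t0 : 0 < t := lt_le_trans ltr01 t1.
rewrite -[LHS]/(ccdf I t) ccdf_1_cdf.
rewrite (_ : cdf I t = (osc_cdf t)%:E); last first.
  exact: (@cdf_lebesgue_stieltjes_id R osc_cdf t).
rewrite -EFinB /osc_cdf subKr max_l// /surv /powR gt_eqF//.
Qed.
End oscillating_law.

(** * Mixtures with an atom *)

Lemma density_probability d (T : measurableType d) (R : realType)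
    (mu : {measure set T -> \bar R}) (g : T -> R) :
  measurable_fun setT g -> (forall x, 0 <= g x) ->
  (\int[mu]_x (g x)%:E = 1)%E ->
  exists Q : probability T R, forall A, measurable A ->
    Q A = (\int[mu]_(x in A) (g x)%:E)%E.
Proof.
move=> mg g0 g1.
pose Q A := (\int[mu]_(x in A) (g x)%:E)%E.
have Q0 : Q set0 = 0%E by rewrite /Q integral_set0.
have Qge0 A : (0 <= Q A)%E by apply: integral_ge0 => x _; rewrite lee_fin.
have Qadd : semi_sigma_additive Q.
  move=> A mA tA mUA; rewrite /Q ge0_integral_bigcup//.
  - apply: is_cvg_ereal_nneg_natsum_cond => n _ _; exact: Qge0.
  - exact/measurable_EFinP/measurable_funTS.
  - by move=> x _; rewrite lee_fin.
pose Qi := isMeasure.Build _ _ _ Q Q0 Qge0 Qadd.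
pose Qm : {measure set T -> \bar R} := HB.pack Q Qi.
pose Qp := Measure_isProbability.Build _ _ _ Qm g1.
pose QP : probability T R := HB.pack Q Qm Qp.
by exists QP.
Qed.

Lemma mixture_dirac d (T : measurableType d) (R : realType)
    (mu : probability T R) (a : T) (p : R) : 0 <= p -> p <= 1 ->
  exists F : probability T R,
    (forall A, measurable A ->
      F A = (p%:E * mu A + (1 - p)%:E * \d_a A)%E) /\
    (forall f : T -> R, measurable_fun setT f -> (forall x, 0 <= f x) ->
      (\int[F]_x (f x)%:E =
       p%:E * \int[mu]_x (f x)%:E + (1 - p)%:E * (f a)%:E)%E).
Proof.
move=> p0 p1.
have q0 : 0 <= 1 - p by rewrite subr_ge0.
pose m : {measure set T -> \bar R} :=
  measure_add (mscale (NngNum p0) mu) (mscale (NngNum q0) \d_a).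
have mE A : m A = (p%:E * mu A + (1 - p)%:E * \d_a A)%E.
  exact: (measure_addE (mscale (NngNum p0) mu) (mscale (NngNum q0) \d_a)).
have m1 : m setT = 1%E.
  by rewrite mE probability_setT diracT !mule1 -EFinD addrC subrK.
pose mp := Measure_isProbability.Build _ _ _ m m1.
pose F : probability T R := HB.pack (Measure.sort m) m mp.
exists F; split => [A mA|f mf f0]; first exact: mE.
have mf' : measurable_fun setT (EFin \o f) by exact/measurable_EFinP.
rewrite [LHS](@ge0_integral_measure_add _ _ _ (mscale (NngNum p0) mu)
  (mscale (NngNum q0) \d_a) _ measurableT)//; last by move=> x _; rewrite lee_fin.
rewrite !ge0_integral_mscale//; try by move=> x _; rewrite lee_fin.
by rewrite integral_dirac// diracT mul1e.
Qed.

Lemma bounded_integrable_prob d (T : measurableType d) (R : realType)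
    (Q : probability T R) (D : set T) (f : T -> R) (M : R) : measurable D ->
  measurable_fun setT f -> (forall x, `|f x| <= M) ->
  Q.-integrable D (EFin \o f).
Proof.
move=> mD mf fM; apply: measurable_bounded_integrable => //.
- by rewrite ltey_eq fin_num_measure.
- exact: measurable_funTS.
- exists M; split; first exact: num_real.
  by move=> x Mx y _ /=; rewrite (le_trans (fM y))// ltW.
Qed.

Lemma integral_addcst d (T : measurableType d) (R : realType)
    (Q : probability T R) (f : T -> R) (M c : R) :
  measurable_fun setT f -> (forall x, `|f x| <= M) ->
  (\int[Q]_x (f x + c)%:E = (\int[Q]_x f x + c)%R%:E)%E.
Proof.
move=> mf fM.
have fi := @bounded_integrable_prob _ _ _ Q _ _ _ measurableT mf fM.
have ci : Q.-integrable setT (EFin \o cst c).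
  by apply: (@bounded_integrable_prob _ _ _ Q _ _ `|c|).
under eq_integral do rewrite EFinD.
have cE : (\int[Q]_x (EFin \o cst c) x = c%:E)%E.
  rewrite [LHS](integral_cst Q measurableT c%:E).
  by rewrite [X in (_ * X)%E]probability_setT mule1.
rewrite (integralD measurableT fi ci) cE.
by rewrite EFinD /Rintegral fineK//; exact: integrable_fin_num.
Qed.

(** A kernel that takes both signs admits an atom that offsets the mean under [mu]. Beyond the atom
    the tail of [mu] is only rescaled by [p], so its asymptotic shape survives. *)
Lemma centered_law (R : realType) (mu : probability R R) (psi : R -> R)
    (M a1 a2 : R) :
  mu (posR R) = 1%E -> measurable_fun setT psi -> (forall x, `|psi x| <= M) ->
  0 < a1 -> 0 < psi a1 -> 0 < a2 -> psi a2 < 0 ->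
  exists (p a : R) (F : probability R R),
    [/\ 0 < p, F (posR R) = 1%E, (\int[F]_x (psi x)%:E = 0)%E &
        forall t, a <= t -> F `]t, +oo[%classic = (p%:E * mu `]t, +oo[%classic)%E].
Proof.
move=> mu1 mpsi psiM a10 psia1 a20 psia2.
pose m := \int[mu]_x psi x.
have [a [a0 psia0 mpsia]] : exists a, [/\ 0 < a, psi a != 0 &
    m * `|psi a| + `|m| * psi a = 0].
  have [m0|m0] := leP 0 m.
    exists a2; split => //; first by rewrite lt_eqF.
    by rewrite (ger0_norm m0) (ltr0_norm psia2) -mulrDr addNr mulr0.
  exists a1; split => //; first by rewrite gt_eqF.
  by rewrite (ltr0_norm m0) (gtr0_norm psia1) mulNr addrN.
(* [psi a] is opposite in sign to the mean [m], so mixing [mu] with the Dirac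
   mass at [a] in these proportions cancels [m]. *)
pose p := `|psi a| / (`|psi a| + `|m|).
have den0 : 0 < `|psi a| + `|m| by rewrite ltr_pwDl// normr_gt0.
have p0 : 0 < p by rewrite divr_gt0// normr_gt0.
have p1 : p <= 1 by rewrite ler_pdivrMr// mul1r lerDl.
have [F [FE FI]] := mixture_dirac mu a (ltW p0) p1.
exists p, a, F; split => //.
- rewrite FE; last exact: measurable_itv.
  rewrite mu1 mule1 diracE mem_set /=; last by rewrite /posR/= in_itv/= a0.
  by rewrite mule1 -EFinD addrC subrK.
(* The integral formula for the mixture covers nonnegative functions only, so it is applied to
   [psi + M]; the constant [M] cancels afterwards. *)
- have M0 x : 0 <= psi x + M.
    by rewrite -lerBlDr sub0r; have := psiM x; rewrite ler_norml => /andP[].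
  have := FI _ (measurable_funD mpsi (measurable_cst M)) M0.
  rewrite !(integral_addcst _ _ mpsi psiM) -!EFinM -EFinD => -[].
  rewrite -/m => h.
  have : \int[F]_x psi x = 0.
    apply: (@addIr _ M); rewrite h add0r.
    transitivity (M + (m * `|psi a| + `|m| * psi a) / (`|psi a| + `|m|));
      last by rewrite mpsia mul0r addr0.
    by rewrite /p; field; rewrite gt_eqF.
  rewrite /Rintegral => h0; rewrite -[LHS]fineK ?h0//.
  apply: integrable_fin_num => //.
  exact: bounded_integrable_prob mpsi psiM.
(* The half-line is open, so the atom lies outside it even when [t = a]. *)
- move=> t at_; rewrite FE// diracE memNset ?mule0 ?adde0//=.
  by rewrite in_itv/= andbT; apply/negP; rewrite -leNgt.
Qed.

(** * Coupling with a Sarmanov density *)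

Lemma ge0_integral_full_measure d (T : measurableType d) (R : realType)
    (Q : probability T R) (C D : set T) (f : T -> \bar R) :
  measurable C -> measurable D -> Q D = 1%E -> measurable_fun setT f ->
  (forall x, 0 <= f x)%E ->
  (\int[Q]_(x in C `&` D) f x = \int[Q]_(x in C) f x)%E.
Proof.
move=> mC mD QD mf f0.
have QC0 : Q (~` D) = 0%E by rewrite probability_setC// QD subee.
rewrite [RHS](ge0_negligible_integral (measurableC mD) mC _ _ QC0)//.
  by rewrite setDE setCK.
exact: measurable_funTS.
Qed.

(** The laws of the constructed variables are known to agree with [F] and [G] on measurable sets,
    not as terms, so products are compared through their values. *)
Lemma eq_product_measure d1 d2 (T1 : measurableType d1) (T2 : measurableType d2)
    (R : realType) (F F' : probability T1 R) (G G' : probability T2 R) :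
  (forall A, measurable A -> F A = F' A) ->
  (forall A, measurable A -> G A = G' A) ->
  forall A, measurable A -> (F \x G)%E A = (F' \x G')%E A.
Proof.
move=> FF' GG' A mA; rewrite /product_measure1.
rewrite (@eq_measure_integral _ _ _ _ F')//=; last by move=> B mB _; exact: FF'.
by apply: eq_integral => x _ /=; apply: GG'; exact: measurable_xsection.
Qed.

Lemma measurable_sarmanov_density (R : realType) (psi1 psi2 : R -> R) (th : R) :
  measurable_fun setT psi1 -> measurable_fun setT psi2 ->
  measurable_fun setT (fun z : R * R => 1 + th * psi1 z.1 * psi2 z.2).
Proof.
move=> mpsi1 mpsi2; apply: measurable_funD => //; apply: measurable_funM.
  by apply: measurable_funM => //; exact: measurableT_comp.
exact: measurableT_comp.
Qed.

Lemma measurable_product_gt (R : realType) (x : R) :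
  measurable [set z : R * R | x < z.1 * z.2].
Proof.
have mM : measurable_fun setT (fun z : R * R => z.1 * z.2).
  by apply: measurable_funM.
have := mM measurableT _ (measurable_itv `]x, +oo[).
rewrite setTI (_ : _ @^-1` _ = [set z : R * R | x < z.1 * z.2])//.
by apply/seteqP; split => z /=; rewrite in_itv/= andbT.
Qed.

Section sarmanov_coupling.
Context {d : measure_display} {T : measurableType d} {R : realType}.
Variables (P : probability T R) (Y : {RV P >-> R}) (F : probability R R).
Variables (psi1 psi2 : R -> R) (th M1 M2 : R).
Hypotheses (mpsi1 : measurable_fun setT psi1) (mpsi2 : measurable_fun setT psi2).
Hypotheses (psi1M : forall x, `|psi1 x| <= M1) (psi2M : forall x, `|psi2 x| <= M2).
Hypothesis dens0 : forall x y, 0 <= 1 + th * psi1 x * psi2 y.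
Hypothesis mean1 : (\int[F]_x (psi1 x)%:E = 0)%E.
Hypothesis mean2 : (\int[distribution P Y]_y (psi2 y)%:E = 0)%E.

Let k (z : R * R) := 1 + th * psi1 z.1 * psi2 z.2.

Let mk : measurable_fun setT k.
Proof. exact: measurable_sarmanov_density. Qed.

(** A centred kernel integrates out: this is why both marginals of the coupling are the prescribed
    ones. *)
Let mean_affine d' (T' : measurableType d') (Q : probability T' R)
    (f : T' -> R) (M c : R) : measurable_fun setT f -> (forall x, `|f x| <= M) ->
  (\int[Q]_x (f x)%:E = 0 -> \int[Q]_x (1 + c * f x)%:E = 1)%E.
Proof.
move=> mf fM f0.
have fi := @bounded_integrable_prob _ _ _ Q _ _ _ measurableT mf fM.
under eq_integral do rewrite addrC.
rewrite (@integral_addcst _ _ _ _ _ (`|c| * M)).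
- rewrite RintegralZl// /Rintegral f0 mulr0 add0r//.
- exact: measurable_funM.
- by move=> x; rewrite normrM ler_wpM2l.
Qed.

Let h (z : R * T) : R * R := (z.1, Y z.2).

Let mh : measurable_fun setT h.
Proof.
apply: measurable_fun_pair => //; exact: measurableT_comp.
Qed.

Let mkh : measurable_fun setT (k \o h).
Proof. exact: measurableT_comp. Qed.

Let kh0 z : 0 <= (k \o h) z.
Proof. exact: dens0. Qed.

Let restr0 (A : set (R * T)) z : (0 <= ((EFin \o (k \o h)) \_ A) z)%E.
Proof. by rewrite patchE; case: ifP => // _; rewrite lee_fin. Qed.

Let mrestr (A : set (R * T)) : measurable A ->
  measurable_fun setT ((EFin \o (k \o h)) \_ A).
Proof.
move=> mA; apply: (proj1 (measurable_restrictT _ mA)).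
exact/measurable_EFinP/measurable_funTS.
Qed.

(** Integrating over the first coordinate first leaves, for each [w], the integral of
    [1 + th * psi2 (Y w) * psi1] under [F], which is 1 by [mean1]. *)
Let law_snd A : measurable A ->
  (\int[F \x P]_(z in setT `*` A) (k (h z))%:E = P A)%E.
Proof.
move=> mA; have mTA := measurableX (@measurableT _ R) mA.
rewrite integral_mkcond fubini_tonelli2; [|exact: mrestr|exact: restr0].
rewrite -[X in _ = _ X]setIT -integral_indic//.
apply: eq_integral => w _; rewrite /fubini_G indicE.
have [wA|wA] := boolP (w \in A).
  rewrite -[RHS](@mean_affine _ _ F psi1 M1 (th * psi2 (Y w)) mpsi1 psi1M mean1).
  apply: eq_integral => x _; rewrite patchE ifT.
    by rewrite /k/= mulrAC.
  by rewrite inE; split => //; exact: set_mem.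
apply: integral0_eq => x _; rewrite patchE ifF//.
by apply/negbTE; apply: contra wA; rewrite !inE => -[].
Qed.

Let law_fst A : measurable A ->
  (\int[F \x P]_(z in A `*` setT) (k (h z))%:E = F A)%E.
Proof.
move=> mA; have mTA := measurableX mA (@measurableT _ T).
rewrite integral_mkcond fubini_tonelli1; [|exact: mrestr|exact: restr0].
rewrite -[X in _ = _ X]setIT -integral_indic//.
apply: eq_integral => x _; rewrite /fubini_F indicE.
have mY : measurable_fun setT (psi2 \o Y) by exact: measurableT_comp.
have i2 : P.-integrable setT (EFin \o (psi2 \o Y)).
  by apply: bounded_integrable_prob mY _ => //= t; exact: psi2M.
have [xA|xA] := boolP (x \in A).
  rewrite -[RHS](@mean_affine _ _ P (psi2 \o Y) M2 (th * psi1 x))//.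
  - apply: eq_integral => w _; rewrite patchE ifT//.
    by rewrite inE; split => //; exact: set_mem.
  - by move=> w; exact: psi2M.
  - rewrite -mean2 integral_distribution//.
    exact/measurable_EFinP.
apply: integral0_eq => w _; rewrite patchE ifF//.
by apply/negbTE; apply: contra xA; rewrite !inE => -[].
Qed.

(** The coupling lives on [R * T], with density [1 + th * psi1 x * psi2 (Y w)] with respect to
    [F \x P]. Keeping the whole of [T] as second factor, not just the values of [Y], preserves the
    given variable [Y] and the law [P]. *)
Lemma sarmanov_coupling : exists P' : probability (R * T)%type R,
  [/\ forall A, measurable A -> P' (fst @^-1` A) = F A,
      forall A, measurable A -> P' (snd @^-1` A) = P A &
      forall C, measurable C -> P' [set z | C (z.1, Y z.2)] =
        (\int[F \x distribution P Y]_(z in C)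
           (1 + th * psi1 z.1 * psi2 z.2)%:E)%E].
Proof.
have [|P' P'E] := density_probability (mu := (F \x P)%E) mkh kh0.
  by have := law_snd measurableT; rewrite setXTT probability_setT.
exists P'; split => [A mA|A mA|C mC].
- rewrite P'E; last by rewrite -[X in measurable X]setTI; exact: measurable_fst.
  by rewrite -law_fst// setXT.
- rewrite P'E; last by rewrite -[X in measurable X]setTI; exact: measurable_snd.
  by rewrite -law_snd// setTX.
have mhC : measurable (h @^-1` C) by rewrite -[X in measurable X]setTI; exact: mh.
rewrite -[[set z | _]]/(h @^-1` C) P'E//.
(* With [F] integrated inside on both sides, the outer integrals over [T] and over the law of [Y]
   agree by change of variables along [Y]. *)
rewrite integral_mkcond fubini_tonelli2; [|exact: mrestr|exact: restr0].
rewrite [RHS]integral_mkcond.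
set f := fun z : R * R => (1 + th * psi1 z.1 * psi2 z.2)%:E.
have f0 z : (0 <= (f \_ C) z)%E.
  by rewrite patchE; case: ifP => // _; rewrite lee_fin.
have mf : measurable_fun setT (f \_ C).
  apply: (proj1 (measurable_restrictT _ mC)).
  exact/measurable_EFinP/measurable_funTS.
rewrite fubini_tonelli2// ge0_integral_distribution//.
- exact: measurable_fun_fubini_tonelli_G.
- by move=> y; apply: integral_ge0 => x _; exact: f0.
Qed.

End sarmanov_coupling.

(** * Tails of the factor and of the product *)

(** Multiplying [x] by [y = expR (pi / be)] shifts the phase [be * ln x] by [pi] and so flips the
    sign of the sine. The ratio of the tails at [x * y] and [x] then keeps depending on the phase of
    [x], which no limit allows, whatever the index [a]. *)
Lemma osc_tail_not_regularly_varying (R : realType) (al be p A : R)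
    (f : R -> R) :
  0 < al -> 0 < be -> 0 < p -> 1 <= A ->
  (forall t, A <= t -> f t = p * (t `^ (- al) * osc al be (ln t))) ->
  forall a, ~ (forall y, 0 < y ->
    asymp_equiv (fun x => f (x * y)) (fun x => y `^ (- a) * f x)).
Proof.
move=> al0 be0 p0 A1 fE a rv.
pose b := osc_coef al be.
have b0 : 0 < b by exact: osc_coef_gt0.
(* Strict because [be] is nonzero; this keeps [1 + b * sin s] positive. *)
have b1 : b < 1.
  by rewrite ltr_pdivrMr ?ltr_pwDl// mul1r ltrDl normr_gt0 gt_eqF.
pose y := expR (pi / be).
have pi2 : 0 < pi *+ 2 :> R by rewrite mulrn_wgt0 ?pi_gt0.
have y0 : 0 < y by exact: expR_gt0.
have y1 : 1 <= y.
  by rewrite -[leLHS]expR0 ler_expR divr_ge0 ?pi_ge0// ltW.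
pose c := y `^ (- al) / y `^ (- a).
have key s : c * (1 - b * sin s) = 1 + b * sin s.
  (* A sequence tending to infinity along which the phase is [s] modulo [2 * pi], so that the ratio
     is constant once past [A]. *)
  pose u (n : nat) := expR ((s + pi *+ 2 *+ n) / be).
  have uy : u n @[n --> \oo] --> +oo.
    apply/cvgryPge => M; near=> n.
    rewrite (le_trans _ (expR_ge1Dx _))// -lerBlDl ler_pdivlMr//.
    rewrite -lerBlDl -mulr_natr -ler_pdivrMl//.
    by near: n; exact: nbhs_infty_ger.
  have lnu n : be * ln (u n) = s + pi *+ 2 *+ n.
    by rewrite expRK mulrC divfK// gt_eqF.
  have oscu n : osc al be (ln (u n)) = 1 + b * sin s.
    by rewrite /osc lnu (periodicn (@sinD2pi R)).
  have oscuy n : osc al be (ln (u n * y)) = 1 - b * sin s.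
    rewrite /osc lnM ?posrE ?expR_gt0// mulrDr lnu expRK.
    rewrite [be * _]mulrC divfK ?gt_eqF// addrAC (periodicn (@sinD2pi R)).
    by rewrite sinDpi mulrN.
  have sb : 0 < 1 + b * sin s.
    rewrite -[ltLHS](subrr 1) ltrD2l ltrNl -mulrN.
    apply: le_lt_trans b1; apply: ler_piMr; first exact: ltW.
    by rewrite lerNl sin_geN1.
  have h := (cvg_pinftyP _ _).1 (rv _ y0) u uy.
  have : (c * ((1 - b * sin s) / (1 + b * sin s))) @[_ --> \oo] --> (1 : R).
    apply: cvg_trans h; apply: near_eq_cvg; near=> k.
    have Au : A <= u k by near: k; move/cvgryPge : uy; exact.
    have u0 : 0 < u k by exact: expR_gt0.
    have Auy : A <= u k * y by rewrite (le_trans Au)// ler_peMr// ltW.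
    rewrite !fE// oscu oscuy powRM ?ltW// /c.
    have aux (q U V Z S S' : R) : q != 0 -> U != 0 -> Z != 0 -> S' != 0 ->
        q * (U * V * S) / (Z * (q * (U * S'))) = V / Z * (S / S').
      by move=> q0 U0 Z0 S0; field; rewrite q0 U0 Z0 S0.
    by apply: aux; apply: lt0r_neq0 => //; exact: powR_gt0.
  move=> /(cvg_unique _ (cvg_cst _)) => /(_ (@norm_hausdorff _ _)) h1.
  move/(congr1 ( *%R^~ (1 + b * sin s))) : h1 => /=.
  by rewrite mul1r -mulrA divfK// lt0r_neq0.
(* The two phases give [c * (1 - b) = 1 + b] and [c * (1 + b) = 1 - b]: adding yields [c = 1],
   subtracting [c = -1]. *)
have := key (pi / 2); have := key (- (pi / 2)).
rewrite sinN sin_pihalf => h1 h2; nra.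
Unshelve. all: by end_near. Qed.

Lemma powR_dominated_integrable (R : realType) (G : {measure set R -> \bar R})
    (al : R) (v : R -> R) (C : R) :
  G.-integrable (posR R) (fun y => (y `^ al)%:E) ->
  measurable_fun (posR R) v ->
  (forall y, 0 < y -> `|v y| <= C * y `^ al) ->
  G.-integrable (posR R) (EFin \o v).
Proof.
move=> ial mv vC.
have mposR : measurable (posR R) by exact: measurable_itv.
apply: (le_integrable mposR _ _ (integrableZl mposR C ial)).
  exact/measurable_EFinP.
move=> y; rewrite /posR/= in_itv/= andbT => y0.
by rewrite lee_fin (le_trans (vC _ y0))// ler_norm.
Qed.

(** Were the integral zero, its nonnegative integrand would vanish almost everywhere; the power
    being positive on [posR R], so would [w], against its positive mass. *)
Lemma weighted_mass_gt0 (R : realType) (G : {measure set R -> \bar R})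
    (al : R) (w : R -> R) :
  measurable_fun (posR R) w -> (forall y, 0 < y -> 0 <= w y) ->
  (0 < \int[G]_(y in posR R) (w y)%:E)%E ->
  G.-integrable (posR R) (fun y => (w y * y `^ al)%:E) ->
  0 < \int[G]_(y in posR R) (w y * y `^ al).
Proof.
move=> mw w0 wi iw.
have mposR : measurable (posR R) by exact: measurable_itv.
have wy0 y : posR R y -> 0 <= w y * y `^ al.
  by rewrite /posR/= in_itv/= andbT => y0; rewrite mulr_ge0 ?powR_ge0 ?w0.
rewrite lt_neqAle Rintegral_ge0// andbT; apply/negP => /eqP i0.
have : ae_eq G (posR R) (fun y => (w y * y `^ al)%:E) (cst 0%E).
  apply/(ae_eq_integral_abs G mposR (measurable_int _ iw)).
  rewrite -[RHS](_ : (\int[G]_(y in posR R) (w y * y `^ al))%:E = 0%E).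
    rewrite /Rintegral fineK; last exact: integrable_fin_num.
    by apply: eq_integral => y /set_mem /wy0 h; rewrite gee0_abs// lee_fin.
  by rewrite -i0.
move=> h; move: wi; rewrite (_ : integral _ _ _ = 0%E) ?ltxx//.
rewrite -[RHS](integral0 G (posR R)).
apply: ae_eq_integral => //; first exact/measurable_EFinP.
apply: filterS h => y h py; have := h py; move: py.
rewrite /posR/= in_itv/= andbT => y0 [] /eqP.
by rewrite mulf_eq0 (gt_eqF (powR_gt0 _ y0)) orbF => /eqP ->.
Qed.

Section product_tail.
Context {R : realType}.
Variables (F G : probability R R) (psi1 psi2 : R -> R).
Variables (th d1 M1 M2 al be p A : R).
Hypotheses (mpsi1 : measurable_fun setT psi1) (mpsi2 : measurable_fun setT psi2).
Hypotheses (psi1M : forall x, `|psi1 x| <= M1) (psi2M : forall x, `|psi2 x| <= M2).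
Hypothesis dens0 : forall x y, 0 <= 1 + th * psi1 x * psi2 y.
Hypothesis psi1_lim : psi1 x @[x --> +oo] --> d1.
Hypotheses (al0 : 0 < al) (p0 : 0 < p) (A1 : 1 <= A).
Hypothesis FE : forall t, A <= t ->
  F `]t, +oo[%classic = (p * (t `^ (- al) * osc al be (ln t)))%:E.
Hypothesis ial : G.-integrable (posR R) (fun y => (y `^ al)%:E).

(** The limit of the Sarmanov density [k (u, y)] as [u] tends to infinity. *)
Let w y := 1 + th * d1 * psi2 y.

Hypothesis mellin_cos :
  \int[G]_(y in posR R) (w y * y `^ al * cos (be * ln y)) = 0.
Hypothesis mellin_sin :
  \int[G]_(y in posR R) (w y * y `^ al * sin (be * ln y)) = 0.

Let k (z : R * R) := 1 + th * psi1 z.1 * psi2 z.2.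

(** The conditional probability of [XY > x] given [Y = y] under the Sarmanov density. *)
Definition tail_kernel x y := \int[F]_(u in [set u | x < u * y]) k (u, y).

Let m := \int[G]_(y in posR R) (w y * y `^ al).

Let mposR : measurable (posR R).
Proof. exact: measurable_itv. Qed.

Let M10 : 0 <= M1. Proof. exact: le_trans (psi1M 0). Qed.
Let M20 : 0 <= M2. Proof. exact: le_trans (psi2M 0). Qed.

Let mk : measurable_fun setT k.
Proof. exact: measurable_sarmanov_density. Qed.

Let kM z : `|k z| <= 1 + `|th| * M1 * M2.
Proof.
rewrite (le_trans (ler_normD _ _))// normr1 lerD2l !normrM.
by rewrite ler_pM ?mulr_ge0// ler_wpM2l.
Qed.

Let wM y : `|w y| <= 1 + `|th| * `|d1| * M2.
Proof.
rewrite (le_trans (ler_normD _ _))// normr1 lerD2l !normrM.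
by rewrite ler_wpM2l// mulr_ge0.
Qed.

Let mw : measurable_fun setT w.
Proof. by apply: measurable_funD => //; exact: measurable_funM. Qed.

Let Fb t := fine (F `]t, +oo[%classic).

Let tail_set (x y : R) : 0 < y -> [set u | x < u * y] = `]x / y, +oo[%classic.
Proof.
move=> y0; apply/seteqP; split => u /=; rewrite in_itv/= andbT.
  by rewrite ltr_pdivrMr.
by rewrite ltr_pdivrMr.
Qed.

Let tail_ge0 (t : R) : 0 <= Fb t.
Proof. by rewrite fine_ge0. Qed.

Let Rintegral_tail_le (f : R -> R) (t c : R) : measurable_fun setT f ->
  F.-integrable setT (EFin \o f) ->
  (forall u, t < u -> `|f u| <= c) ->
  `|\int[F]_(u in `]t, +oo[) f u| <= c * Fb t.
Proof.
move=> mf intf fc.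
have mt : measurable `]t, +oo[%classic by exact: measurable_itv.
have fi : F.-integrable `]t, +oo[%classic (EFin \o f).
  exact: integrableS intf.
rewrite (le_trans (le_normr_Rintegral _ _))//.
rewrite /Fb -[leRHS](Rintegral_cst F mt); apply: le_Rintegral => //.
- exact: (integrable_norm fi).
- by apply: (@bounded_integrable_prob _ _ _ F _ (cst c) `|c|).
by move=> u /=; rewrite in_itv/= andbT; exact: fc.
Qed.

Let mky (y : R) : measurable_fun setT (fun u => k (u, y)).
Proof.
have mu : measurable_fun setT (fun u : R => (u, y)).
  by apply: measurable_fun_pair.
exact: measurableT_comp mk mu.
Qed.

Let k_integrable (y : R) : F.-integrable setT (EFin \o (fun u => k (u, y))).
Proof.
exact: (@bounded_integrable_prob _ _ _ F _ _ (1 + `|th| * M1 * M2)).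
Qed.

Let tail_kernel_le (x y : R) : 0 < y ->
  `|tail_kernel x y| <= (1 + `|th| * M1 * M2) * Fb (x / y).
Proof.
by move=> y0; rewrite /tail_kernel tail_set//; exact: Rintegral_tail_le.
Qed.

(** For [u > x / y] the density [k (u, y)] differs from its limit [w y] by
    [th * (psi1 u - d1) * psi2 y], at most [|th| * e * M2] in absolute value. *)
Let tail_kernel_approx (x y e : R) : 0 < y ->
  (forall u, x / y < u -> `|psi1 u - d1| <= e) ->
  `|tail_kernel x y - w y * Fb (x / y)| <= `|th| * e * M2 * Fb (x / y).
Proof.
move=> y0 he; rewrite /tail_kernel tail_set//.
have mt : measurable `]x / y, +oo[%classic by exact: measurable_itv.
rewrite -(Rintegral_cst F mt) -RintegralB//.
- apply: Rintegral_tail_le.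
  + by apply: measurable_funB.
  + rewrite (_ : _ \o _ = ((EFin \o (fun u => k (u, y))) \- (EFin \o cst (w y)))%E).
      apply: integrableB => //.
      exact: (@bounded_integrable_prob _ _ _ F _ (cst (w y)) `|w y|).
    by apply/funext => u /=; rewrite EFinB.
  + move=> u xu; rewrite (_ : _ - _ = th * (psi1 u - d1) * psi2 y).
      by rewrite !normrM ler_pM// ?mulr_ge0// ler_wpM2l// he.
    by rewrite /k /w /=; ring.
- exact: integrableS (k_integrable y).
- exact: (@bounded_integrable_prob _ _ _ F _ (cst (w y)) `|w y|).
Qed.

Let Fb_scaled (t : R) : A <= t -> t `^ al * Fb t = p * osc al be (ln t).
Proof.
move=> At; have t0 : 0 < t by rewrite (lt_le_trans ltr01)// (le_trans A1).
rewrite /Fb FE//= mulrCA; congr (p * _).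
by rewrite mulrA powRN mulfV ?mul1r// gt_eqF// powR_gt0.
Qed.

(** From [A] on the exact formula gives at most [2 * p]; before [A] the power is at most its value
    at [A] and the probability at most 1. The sum covers both cases and makes the domination uniform
    in [x]. *)
Let Fb_scaled_le (t : R) : 0 < t -> t `^ al * Fb t <= A `^ al + 2 * p.
Proof.
move=> t0; have [At|tA] := leP A t.
  rewrite Fb_scaled// mulrC (le_trans (ler_wpM2r (ltW p0) (osc_le2 _ _ _)))//.
  by rewrite lerDr powR_ge0.
rewrite -[leLHS]addr0 lerD ?mulr_ge0 ?(ltW p0)//.
rewrite -[leRHS]mulr1 ler_pM ?powR_ge0//.
  by rewrite ge0_ler_powR// ?nnegrE ?(ltW al0) ?(ltW t0) ?(ltW tA)// (le_trans _ A1).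
by rewrite -lee_fin /Fb fineK ?fin_num_measure// probability_le1.
Qed.

(* The limit of [x `^ al * tail_kernel x y] oscillates with [x], so dominated
   convergence is applied to the difference, whose limit is 0. *)
Let h x y :=
  x `^ al * tail_kernel x y - p * (w y * y `^ al * osc al be (ln x - ln y)).

(** Gives the tail at [x / y] its own power and leaves that of [y], the integrable majorant. *)
Let scaleE (x y : R) : 0 < x -> 0 < y -> x `^ al = y `^ al * (x / y) `^ al.
Proof.
move=> x0 y0; rewrite -powRM ?(ltW y0) ?divr_ge0 ?(ltW x0) ?(ltW y0)//.
by rewrite mulrC divfK// gt_eqF.
Qed.

(** The first summand bounds the scaled kernel, by the bound of the density times that of the scaled
    tail; the second bounds the limiting term, with [osc <= 2]. *)
Let hC := (1 + `|th| * M1 * M2) * (A `^ al + 2 * p) +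
  p * ((1 + `|th| * `|d1| * M2) * 2).

Let h_le (x y : R) : 0 < x -> 0 < y -> `|h x y| <= hC * y `^ al.
Proof.
move=> x0 y0; rewrite (le_trans (ler_normB _ _))// /hC [leRHS]mulrDl lerD//.
  rewrite normrM (ger0_norm (powR_ge0 _ _)) (scaleE x0 y0).
  rewrite -[leLHS]mulrA [leRHS]mulrC; apply: ler_wpM2l; first exact: powR_ge0.
  rewrite (le_trans (ler_wpM2l (powR_ge0 _ _) (tail_kernel_le _ y0)))//.
  rewrite mulrCA ler_wpM2l ?Fb_scaled_le ?divr_gt0//.
  by rewrite addr_ge0 ?mulr_ge0.
rewrite normrM (gtr0_norm p0) -[leRHS]mulrA; apply: ler_wpM2l; first exact: ltW.
rewrite !normrM (ger0_norm (powR_ge0 _ _)) [leRHS]mulrAC ler_pM//.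
- by rewrite mulr_ge0 ?powR_ge0.
- by rewrite ler_wpM2r ?powR_ge0.
- by rewrite ger0_norm ?osc_ge0 ?osc_le2.
Qed.

Let h_cvg (y : R) : 0 < y -> h x y @[x --> +oo] --> 0.
Proof.
move=> y0; apply/cvgr0Pnorm_le => e e0.
pose c := y `^ al * (`|th| * M2 * (2 * p)).
have c0 : 0 <= c by rewrite mulr_ge0 ?powR_ge0 ?mulr_ge0// ltW.
(* The final error is at most [c * e']; the [+ 1] allows for [c = 0]. *)
pose e' := e / (c + 1).
have e'0 : 0 < e' by rewrite divr_gt0// ltr_wpDl.
have [B [_ HB]] : \forall u \near +oo, `|psi1 u - d1| <= e'.
  by move/cvgrPdist_le : psi1_lim => /(_ _ e'0); under eq_near do rewrite distrC.
near=> x.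
have x0 : 0 < x by near: x; exact: nbhs_pinfty_gt.
have Ax : A <= x / y.
  by rewrite ler_pdivlMr//; near: x; exact: nbhs_pinfty_ge.
have Bx : B <= x / y.
  by rewrite ler_pdivlMr//; near: x; exact: nbhs_pinfty_ge.
have := @tail_kernel_approx x y e' y0.
move=> /(_ (fun u xu => HB _ (le_lt_trans Bx xu))) => hk.
(* Once [x / y] reaches [A], the scaled tail is exactly [p * osc], so the only error left comes from
   replacing [psi1] by its limit. *)
rewrite /h (_ : _ - _ = x `^ al * (tail_kernel x y - w y * Fb (x / y))); last first.
  rewrite mulrBr; congr (_ - _); rewrite (scaleE x0 y0).
  rewrite [RHS](_ : _ = w y * y `^ al * ((x / y) `^ al * Fb (x / y))); last by ring.
  by rewrite Fb_scaled// ln_div ?posrE//; ring.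
rewrite normrM (ger0_norm (powR_ge0 _ _)).
rewrite (le_trans (ler_wpM2l (powR_ge0 _ _) hk))// (scaleE x0 y0).
rewrite [leLHS](_ : _ = y `^ al * (`|th| * M2 * ((x / y) `^ al * Fb (x / y))) * e');
  last by ring.
rewrite (@le_trans _ _ (c * e'))//.
  rewrite ler_wpM2r ?(ltW e'0)// ler_wpM2l ?powR_ge0// ler_wpM2l ?mulr_ge0//.
  rewrite Fb_scaled// mulrC ler_wpM2r ?(ltW p0)//; exact: osc_le2.
by rewrite /e' mulrCA ger_pMr// ler_pdivrMr ?ltr_wpDl// mul1r lerDl.
Unshelve. all: by end_near. Qed.

Let EFin_tail_kernel (x y : R) : (tail_kernel x y)%:E =
  fubini_G F ((EFin \o k) \_ [set z | x < z.1 * z.2]) y.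
Proof.
have mx : measurable [set u | x < u * y].
  have := measurable_ysection y (measurable_product_gt x).
  rewrite (_ : ysection _ _ = [set u | x < u * y])//.
  by apply/seteqP; split => u; rewrite /ysection /= inE.
rewrite /tail_kernel /Rintegral fineK; last first.
  exact/(integrable_fin_num mx)/(integrableS measurableT mx)/k_integrable.
rewrite /fubini_G integral_mkcond; apply: eq_integral => u _.
by rewrite !patchE; congr (if _ then _ else _).
Qed.

Let restr0 x z : (0 <= ((EFin \o k) \_ [set z | (x < z.1 * z.2)%R]) z)%E.
Proof. by rewrite patchE; case: ifP => // _; rewrite lee_fin; exact: dens0. Qed.

Let mrestr x : measurable_fun setT ((EFin \o k) \_ [set z | x < z.1 * z.2]).
Proof.
apply: (proj1 (measurable_restrictT _ (measurable_product_gt x))).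
exact/measurable_EFinP/measurable_funTS.
Qed.

Let measurable_tail_kernel x : measurable_fun setT (tail_kernel x).
Proof.
apply/measurable_EFinP; rewrite (_ : _ \o _ =
    fubini_G F ((EFin \o k) \_ [set z | x < z.1 * z.2])).
  by apply: measurable_fun_fubini_tonelli_G; [exact: mrestr|exact: restr0].
by apply/funext => y /=; exact: EFin_tail_kernel.
Qed.

Lemma product_tailE (x : R) : G (posR R) = 1%E ->
  (\int[F \x G]_(z in [set z | (x < z.1 * z.2)%R]) (k z)%:E)%E =
  (\int[G]_(y in posR R) (tail_kernel x y)%:E)%E.
Proof.
move=> G1; rewrite integral_mkcond fubini_tonelli2; [|exact: mrestr|exact: restr0].
rewrite -[X in _ = integral _ X _](setTI (posR R)) ge0_integral_full_measure//.
- by apply: eq_integral => y _; rewrite EFin_tail_kernel.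
- exact/measurable_EFinP.
- move=> y; rewrite EFin_tail_kernel.
  by apply: integral_ge0 => u _; exact: restr0.
Qed.

Let trig_integrable (v : R -> R) : measurable_fun (posR R) v ->
  (forall y, `|v y| <= 1) ->
  G.-integrable (posR R) (EFin \o (fun y => w y * y `^ al * v y)).
Proof.
move=> mv v1; apply: (powR_dominated_integrable (C := 1 + `|th| * `|d1| * M2) ial).
  apply: measurable_funM => //; apply: measurable_funTS.
  by apply: measurable_funM => //; exact: measurable_powR.
move=> y y0; rewrite !normrM (ger0_norm (powR_ge0 _ _)) -[leRHS]mulr1 ler_pM//.
  by rewrite mulr_ge0 ?powR_ge0.
by rewrite ler_wpM2r ?powR_ge0.
Qed.

Let mass_integrable : G.-integrable (posR R) (EFin \o (fun y => w y * y `^ al)).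
Proof.
rewrite (_ : (fun y => _) = (fun y => w y * y `^ al * 1)).
  by apply: (@trig_integrable (cst 1)) => // y; rewrite normr1.
by apply/funext => y; rewrite mulr1.
Qed.

Let cos_integrable :
  G.-integrable (posR R) (EFin \o (fun y => w y * y `^ al * cos (be * ln y))).
Proof.
apply: trig_integrable => [|y]; last by rewrite ler_norml cos_geN1 cos_le1.
have mcos : measurable_fun setT (@cos R).
  by apply: continuous_measurable_fun; exact: continuous_cos.
apply: measurable_funTS; apply: (measurableT_comp mcos).
by apply: measurable_funM => //; exact: measurable_ln.
Qed.

Let sin_integrable :
  G.-integrable (posR R) (EFin \o (fun y => w y * y `^ al * sin (be * ln y))).
Proof.
apply: trig_integrable => [|y]; last by rewrite ler_norml sin_geN1 sin_le1.
have msin : measurable_fun setT (@sin R).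
  by apply: continuous_measurable_fun; exact: continuous_sin.
apply: measurable_funTS; apply: (measurableT_comp msin).
by apply: measurable_funM => //; exact: measurable_ln.
Qed.

(** The addition formula separates [x] from [y]: the [y] parts are the integrands of [mellin_cos]
    and [mellin_sin], so integration in [y] leaves only the mass [m], for every [x]. *)
Let oscE x y : w y * y `^ al * osc al be (ln x - ln y) =
  w y * y `^ al +
  (osc_coef al be * sin (be * ln x) * (w y * y `^ al * cos (be * ln y)) -
   osc_coef al be * cos (be * ln x) * (w y * y `^ al * sin (be * ln y))).
Proof. by rewrite /osc mulrBr sinB; ring. Qed.

Let scaled_integrable (f : R -> R) c : G.-integrable (posR R) (EFin \o f) ->
  G.-integrable (posR R) (EFin \o (fun y => c * f y)).
Proof.
move=> fi; rewrite (_ : _ \o _ = (fun y => c%:E * (EFin \o f) y)%E).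
  exact: integrableZl.
by apply/funext => y /=; rewrite EFinM.
Qed.

Let diff_integrable (f g : R -> R) : G.-integrable (posR R) (EFin \o f) ->
  G.-integrable (posR R) (EFin \o g) ->
  G.-integrable (posR R) (EFin \o (fun y => f y - g y)).
Proof.
move=> fi gi; rewrite (_ : _ \o _ = ((EFin \o f) \- (EFin \o g))%E).
  exact: integrableB.
by apply/funext => y /=; rewrite EFinB.
Qed.

Let osc_integral x :
  \int[G]_(y in posR R) (w y * y `^ al * osc al be (ln x - ln y)) = m.
Proof.
under eq_Rintegral do rewrite oscE.
rewrite RintegralD//; last by apply: diff_integrable; exact: scaled_integrable.
rewrite RintegralB//; [|exact: scaled_integrable|exact: scaled_integrable].
by rewrite !RintegralZl// mellin_cos mellin_sin !mulr0 subr0 addr0.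
Qed.

Let osc_integrable x : G.-integrable (posR R)
  (EFin \o (fun y => w y * y `^ al * osc al be (ln x - ln y))).
Proof.
pose r y := osc_coef al be * sin (be * ln x) * (w y * y `^ al * cos (be * ln y)) -
  osc_coef al be * cos (be * ln x) * (w y * y `^ al * sin (be * ln y)).
pose q y := w y * y `^ al.
rewrite (_ : _ \o _ = ((EFin \o q) \+ (EFin \o r))%E).
  by apply: integrableD => //; apply: diff_integrable; exact: scaled_integrable.
by apply/funext => y /=; rewrite oscE EFinD.
Qed.

Let tail_kernel_integrable x : 0 < x ->
  G.-integrable (posR R) (EFin \o tail_kernel x).
Proof.
move=> x0.
apply: (powR_dominated_integrable
  (C := (1 + `|th| * M1 * M2) * ((A `^ al + 2 * p) / x `^ al)) ial).
  exact: measurable_funTS.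
move=> y y0; rewrite (le_trans (tail_kernel_le _ y0))// -[leRHS]mulrA.
rewrite ler_wpM2l ?addr_ge0 ?mulr_ge0//.
have xa : 0 < x `^ al by rewrite powR_gt0.
rewrite [leRHS]mulrAC ler_pdivlMr// (scaleE x0 y0) [leLHS]mulrCA [leRHS]mulrC.
by rewrite ler_wpM2l ?powR_ge0// [leLHS]mulrC Fb_scaled_le ?divr_gt0.
Qed.

Let h_integrable x : 0 < x -> G.-integrable (posR R) (EFin \o h x).
Proof.
move=> x0; apply: diff_integrable; apply: scaled_integrable.
  exact: tail_kernel_integrable.
exact: osc_integrable.
Qed.

Let h_integral x : 0 < x -> \int[G]_(y in posR R) h x y =
  x `^ al * \int[G]_(y in posR R) tail_kernel x y - p * m.
Proof.
move=> x0; rewrite RintegralB//; last 2 first.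
- exact/scaled_integrable/tail_kernel_integrable.
- exact/scaled_integrable/osc_integrable.
by rewrite !RintegralZl ?osc_integral//; exact: tail_kernel_integrable.
Qed.

Lemma scaled_product_tail_cvg :
  x `^ al * \int[G]_(y in posR R) tail_kernel x y @[x --> +oo] --> p * m.
Proof.
apply/cvg_pinftyP => u uy.
(* Domination and integrability of [h] are available for positive [x] only, while early terms of [u]
   may be nonpositive; [v] agrees with [u] from some rank on. *)
pose v n := Order.max (u n) 1.
have v0 n : 0 < v n by rewrite lt_max ltr01 orbT.
have vy : v n @[n --> \oo] --> +oo.
  apply/cvgryPge => B; near=> n; rewrite le_max; apply/orP; left.
  by near: n; move/cvgryPge : uy; exact.
have uv : \forall n \near \oo, v n = u n.
  near=> n; rewrite /v max_l//.
  by near: n; move/cvgryPge : uy; exact.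
have hn0 : {ae G, forall y, posR R y -> (h (v n) y)%:E @[n --> \oo] --> 0%E}.
  apply: aeW => y; rewrite /posR/= in_itv/= andbT => y0.
  apply: cvg_EFin; first exact: nearW.
  by have /cvg_pinftyP := h_cvg y0; exact.
have hn_le : {ae G, forall y n, posR R y ->
    (`|(h (v n) y)%:E| <= hC%:E * (y `^ al)%:E)%E}.
  apply: aeW => y n; rewrite /posR/= in_itv/= andbT => y0.
  by rewrite lee_fin h_le.
have [_ _] := dominated_convergence mposR
  (fun n => measurable_int _ (h_integrable (v0 n))) (measurable_cst 0%E)
  hn0 (integrableZl mposR hC ial) hn_le.
rewrite integral0 => /fine_cvg /= hcvg.
rewrite -[X in _ --> X]add0r; apply: cvg_trans; last first.
  exact: (cvgD hcvg (cvg_cst (p * m))).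
apply: near_eq_cvg; near=> n.
have uvn : v n = u n by near: n.
rewrite -[LHS]/(\int[G]_(y in posR R) h (v n) y + p * m) h_integral//.
by rewrite subrK uvn.
Unshelve. all: by end_near. Qed.


End product_tail.

(** * Regular variation from a scaled limit; moment and Mellin conditions *)

(** The scaled tails at [x * y] and at [x] have the same nonzero limit [L]; in their quotient the
    powers of [x] cancel and that of [y] remains. *)
Lemma regularly_varying_scaled (R : realType) (f : R -> R) (al L : R) :
  0 < L -> x `^ al * f x @[x --> +oo] --> L ->
  forall y, 0 < y -> asymp_equiv (fun x => f (x * y)) (fun x => y `^ (- al) * f x).
Proof.
move=> L0 fL y y0.
have fLy : (x * y) `^ al * f (x * y) @[x --> +oo] --> L.
  have yy : x * y @[x --> +oo] --> +oo.
    apply/cvgryPge => M; near=> t; rewrite -ler_pdivrMr//.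
  exact: cvg_comp yy fL.
rewrite /asymp_equiv -(mulfV (lt0r_neq0 L0)).
apply: cvg_trans (cvgM fLy (cvgV (lt0r_neq0 L0) fL)).
apply: near_eq_cvg; near=> x.
have x0 : 0 < x by near: x; exact: nbhs_pinfty_gt.
have xa : x `^ al != 0 by rewrite gt_eqF// powR_gt0.
have ya : y `^ al != 0 by rewrite gt_eqF// powR_gt0.
rewrite /= powRM ?ltW// powRN !invfM invrK.
rewrite [LHS](_ : _ = (x `^ al / x `^ al) * (y `^ al * f (x * y) / f x)); last by ring.
by rewrite mulfV// mul1r; ring.
Unshelve. all: by end_near. Qed.

(** On []0, 1]] the power is at most 1, beyond 1 it is at most the power with exponent [al + eps];
    the sum of both majorants is integrable. *)
Lemma lower_moment_integrable (R : realType) (G : probability R R) (al eps : R) :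
  0 < al -> 0 < eps ->
  (\int[G]_(y in posR R) (y `^ (al + eps))%:E < +oo)%E ->
  G.-integrable (posR R) (fun y => (y `^ al)%:E).
Proof.
move=> al0 eps0 mom.
have mposR : measurable (posR R) by exact: measurable_itv.
have mpow r : measurable_fun (posR R) (fun y : R => (y `^ r)%:E).
  by apply/measurable_EFinP/measurable_funTS; exact: measurable_powR.
have i1 : G.-integrable (posR R) (EFin \o cst 1).
  exact: (@bounded_integrable_prob _ _ _ G _ _ `|1|).
have i2 : G.-integrable (posR R) (fun y => (y `^ (al + eps))%:E).
  apply/integrableP; split=> //; apply: le_lt_trans mom.
  rewrite le_eqVlt; apply/orP; left; apply/eqP.
  by apply: eq_integral => y _; rewrite gee0_abs// lee_fin powR_ge0.
apply: (le_integrable mposR (mpow _) _ (integrableD mposR i1 i2)).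
move=> y; rewrite /posR/= in_itv/= andbT => y0.
rewrite lee_fin ger0_norm ?powR_ge0// ger0_norm ?addr_ge0 ?powR_ge0//.
have [y1|y1] := leP y 1.
  rewrite (le_trans (ge0_ler_powR _ _ _ y1)) ?nnegrE ?(ltW al0) ?(ltW y0)//.
  by rewrite powR1 lerDl powR_ge0.
by rewrite (@le_trans _ _ (y `^ (al + eps)))// ?lerDr// ler_powR ?(ltW y1)// lerDl ltW.
Qed.

Lemma bounded_patch (R : realType) (E : set R) (phi : R -> R) :
  [bounded phi x | x in E] -> exists M, forall x, `|(phi \_ E) x| <= M.
Proof.
(* The bound is granted for constants strictly above [M0], hence [M0 + 1]; the maximum with 0 covers
   the points outside [E]. *)
move=> [M0 [_ HM]]; exists (Order.max (M0 + 1) 0) => x; rewrite patchE.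
case: ifPn => [xE|_]; last by rewrite normr0 le_max lexx orbT.
by rewrite le_max (HM (M0 + 1)) ?ltrDl//; exact: set_mem.
Qed.

(** The real and imaginary parts of the Mellin equation are its cosine and sine versions; [trig]
    lets later arguments treat both at once. *)
Lemma mellin_parts (R : realType) (G : probability R R) (phi : R -> R)
    (c al be : R) :
  cintegral G (posR R) (fun y => cpow y (al +i* be)%C) +
    c%:C%C * cintegral G (posR R)
      (fun y => (phi y)%:C%C * cpow y (al +i* be)%C) = 0 ->
  forall trig : R -> R, trig = cos \/ trig = sin ->
  \int[G]_(y in posR R) (y `^ al * trig (be * ln y)) +
    c * \int[G]_(y in posR R) (phi y * (y `^ al * trig (be * ln y))) = 0.
Proof.
rewrite /cintegral => /eqP; rewrite eq_complex /= => /andP[/eqP re /eqP im].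
move=> trig [] ->.
- rewrite -[RHS]re !mul0r subr0; congr (_ + _ * _).
  by apply: eq_Rintegral => y _; rewrite mul0r subr0.
- rewrite -[RHS]im !mul0r addr0; congr (_ + _ * _).
  by apply: eq_Rintegral => y _; rewrite mul0r addr0.
Qed.

Lemma trig_norm_le1 (R : realType) (trig : R -> R) : trig = cos \/ trig = sin ->
  measurable_fun setT trig /\ forall x, `|trig x| <= 1.
Proof.
case=> ->; split.
- by apply: continuous_measurable_fun; exact: continuous_cos.
- by move=> x; rewrite ler_norml cos_geN1 cos_le1.
- by apply: continuous_measurable_fun; exact: continuous_sin.
- by move=> x; rewrite ler_norml sin_geN1 sin_le1.
Qed.

(** Passing from [be] to its absolute value costs at most a sign, [cos] being even and [sin] odd;
    the two integrals then combine by linearity. *)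
Lemma weighted_mellin0 (R : realType) (G : probability R R) (phi : R -> R)
    (c al be M : R) (trig : R -> R) :
  measurable_fun setT phi -> (forall x, `|phi x| <= M) ->
  G.-integrable (posR R) (fun y => (y `^ al)%:E) ->
  trig = cos \/ trig = sin ->
  \int[G]_(y in posR R) (y `^ al * trig (be * ln y)) +
    c * \int[G]_(y in posR R) (phi y * (y `^ al * trig (be * ln y))) = 0 ->
  \int[G]_(y in posR R) ((1 + c * phi y) * y `^ al * trig (`|be| * ln y)) = 0.
Proof.
move=> mphi phiM ial ctrig h.
have mposR : measurable (posR R) by exact: measurable_itv.
have [mtrig trig1] := trig_norm_le1 ctrig.
have [s hs] : exists s : R, forall x, trig (`|be| * x) = s * trig (be * x).
  have [b0|b0] := leP 0 be.
    by exists 1 => x; rewrite mul1r ger0_norm.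
  case: ctrig => ->; [exists 1|exists (-1)] => x; rewrite ltr0_norm// mulNr.
    by rewrite cosN mul1r.
  by rewrite sinN mulN1r.
have mt : measurable_fun setT (fun y => y `^ al * trig (be * ln y)).
  apply: measurable_funM; first exact: measurable_powR.
  apply: (measurableT_comp mtrig).
  by apply: measurable_funM => //; exact: measurable_ln.
have i1 : G.-integrable (posR R) (EFin \o (fun y => y `^ al * trig (be * ln y))).
  apply: (powR_dominated_integrable (C := 1) ial); first exact: measurable_funTS.
  move=> y y0; rewrite normrM ger0_norm ?powR_ge0// mulrC.
  by rewrite ler_wpM2r ?powR_ge0.
have i2 : G.-integrable (posR R)
    (EFin \o (fun y => phi y * (y `^ al * trig (be * ln y)))).
  apply: (powR_dominated_integrable (C := M) ial).
    by apply: measurable_funTS; exact: measurable_funM.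
  move=> y y0; rewrite 2!normrM (ger0_norm (powR_ge0 _ _)).
  rewrite ler_pM// ?mulr_ge0 ?powR_ge0// -[leRHS]mulr1.
  by rewrite ler_wpM2l ?powR_ge0.
have i3 : G.-integrable (posR R)
    (EFin \o (fun y => c * (phi y * (y `^ al * trig (be * ln y))))).
  rewrite (_ : _ \o _ = (fun y => c%:E *
    (EFin \o (fun y => (phi y * (y `^ al * trig (be * ln y)))%R)) y)%E).
    exact: integrableZl.
  by apply/funext => y /=; rewrite EFinM.
have i4 : G.-integrable (posR R) (EFin \o (fun y => y `^ al * trig (be * ln y) +
    c * (phi y * (y `^ al * trig (be * ln y))))).
  rewrite (_ : _ \o _ = (EFin \o (fun y => (y `^ al * trig (be * ln y))%R)) \+
    (EFin \o (fun y => (c * (phi y * (y `^ al * trig (be * ln y))))%R)))%E.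
    exact: integrableD.
  by apply/funext => y /=; rewrite EFinD.
transitivity (\int[G]_(y in posR R) (s * (y `^ al * trig (be * ln y) +
    c * (phi y * (y `^ al * trig (be * ln y)))))).
  by apply: eq_Rintegral => y _; rewrite hs; ring.
by rewrite RintegralZl// RintegralD// RintegralZl// h mulr0.
Qed.

(** * Construction of the pair and verification of its properties *)

Theorem theorem5p2 (R : realType)
    (G : probability R R)
    (hG : G (posR R) = 1%E)
    (phi1 phi2 : R -> R) (theta d1 : R)
    (mphi1 : measurable_fun (posR R) phi1)
    (mphi2 : measurable_fun (posR R) phi2)
    (bphi1 : [bounded phi1 x | x in posR R])
    (bphi2 : [bounded phi2 y | y in posR R])
    (phi1_pos : exists2 x : R, 0 < x & 0 < phi1 x)
    (phi1_neg : exists2 x : R, 0 < x & phi1 x < 0)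
    (phi1_lim : phi1 x @[x --> +oo] --> d1)
    (density_ge0 : forall x y : R, 0 < x -> 0 < y ->
      0 <= 1 + theta * phi1 x * phi2 y)
    (phi2_mean0 : (\int[G]_(y in posR R) (phi2 y)%:E = 0)%E)
    (alpha eps beta0 : R) (alpha_gt0 : 0 < alpha) (eps_gt0 : 0 < eps)
    (moment : (\int[G]_(y in posR R) (y `^ (alpha + eps))%:E < +oo)%E)
    (mellin0 :
      cintegral G (posR R) (fun y => cpow y (alpha +i* beta0)%C) +
      (theta * d1)%:C%C *
      cintegral G (posR R)
        (fun y => (phi2 y)%:C%C * cpow y (alpha +i* beta0)%C) = 0)
    (d : measure_display) (T : measurableType d) (P : probability T R)
    (Y : {RV P >-> R})
    (YG : forall A : set R, measurable A ->
      distribution P Y A = G A) :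
  exists (d' : measure_display) (T' : measurableType d')
    (P' : probability T' R) (pi : {mfun T' >-> T}) (X : {RV P' >-> R}),
    let Y' : {RV P' >-> R} := (Y \o pi : {mfun T' >-> R}) in
    [/\ forall A : set T, measurable A -> distribution P' pi A = P A,
        ~ (exists a : R, regularly_varying_tail P' X a),
        bivariate_sarmanov X Y' (posR R) (posR R) phi1 phi2 theta &
        regularly_varying_tail P' (X \* Y') alpha].
Proof.
have mposR : measurable (posR R) by exact: measurable_itv.
have posRE x : posR R x = (0 < x) :> Prop by rewrite /posR/= in_itv/= andbT.
have [M1 psi1M] := bounded_patch bphi1.
have [M2 psi2M] := bounded_patch bphi2.
(* Extended by 0 outside [posR R], the kernels are bounded and measurable on the whole line, and the
   density is 1 when either argument lies outside. *)
set psi1 := phi1 \_ (posR R) in psi1M.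
set psi2 := phi2 \_ (posR R) in psi2M.
have psi1E x : 0 < x -> psi1 x = phi1 x.
  by move=> x0; rewrite /psi1 patchE mem_set// posRE.
have psi2E x : 0 < x -> psi2 x = phi2 x.
  by move=> x0; rewrite /psi2 patchE mem_set// posRE.
have mpsi1 : measurable_fun setT psi1 by exact: (proj1 (measurable_restrictT _ _)).
have mpsi2 : measurable_fun setT psi2 by exact: (proj1 (measurable_restrictT _ _)).
have dens0 x y : 0 <= 1 + theta * psi1 x * psi2 y.
  have [x0|x0] := boolP (x \in posR R); last first.
    by rewrite /psi1 patchE (negbTE x0) mulr0 mul0r addr0.
  have [y0|y0] := boolP (y \in posR R); last first.
    by rewrite /psi2 patchE (negbTE y0) mulr0 addr0.
  move: x0 y0; rewrite !inE !posRE => x0 y0.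
  by rewrite psi1E// psi2E//; exact: density_ge0.
have psi1_lim : psi1 x @[x --> +oo] --> d1.
  apply: cvg_trans phi1_lim; apply: near_eq_cvg; near=> x.
  by rewrite psi1E.
have psi2_mean : (\int[G]_y (psi2 y)%:E = 0)%E.
  rewrite -phi2_mean0 [RHS]integral_mkcond; apply: eq_integral => y _.
  by rewrite /psi2 restrict_EFin.
pose w y := 1 + theta * d1 * psi2 y.
(* A limit of nonnegative densities as [x] tends to infinity. *)
have w0 y : 0 <= w y.
  have : 1 + theta * psi1 x * psi2 y @[x --> +oo] --> w y.
    apply: cvgD; first exact: cvg_cst.
    by apply: cvgM; [apply: cvgM => //|]; exact: cvg_cst.
  move=> wl; rewrite -(cvg_lim (@norm_hausdorff _ _) wl).
  by apply: limr_ge; [apply/cvg_ex; exists (w y)|exact: nearW].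
have ial := lower_moment_integrable alpha_gt0 eps_gt0 moment.
have mw : measurable_fun setT w.
  by apply: measurable_funD => //; exact: measurable_funM.
have wi : (\int[G]_(y in posR R) (w y)%:E = 1)%E.
  rewrite -(setTI (posR R)) ge0_integral_full_measure//.
  - under eq_integral do rewrite /w addrC.
    rewrite (@integral_addcst _ _ _ _ _ (`|theta * d1| * M2)).
    + rewrite RintegralZl//; last exact: bounded_integrable_prob mpsi2 psi2M.
      by rewrite /Rintegral psi2_mean mulr0 add0r.
    + exact: measurable_funM.
    + by move=> y; rewrite normrM ler_wpM2l.
  - exact/measurable_EFinP.
have wM y : `|w y| <= 1 + `|theta * d1| * M2.
  by rewrite (le_trans (ler_normD _ _))// normr1 lerD2l normrM ler_wpM2l.
have iw : G.-integrable (posR R) (fun y => (w y * y `^ alpha)%:E).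
  apply: (powR_dominated_integrable (v := fun y => w y * y `^ alpha)
    (C := 1 + `|theta * d1| * M2) ial).
    by apply: measurable_funTS; apply: measurable_funM => //; exact: measurable_powR.
  by move=> y y0; rewrite normrM (ger0_norm (powR_ge0 _ _)) ler_wpM2r ?powR_ge0.
have m0 : 0 < \int[G]_(y in posR R) (w y * y `^ alpha).
  apply: weighted_mass_gt0 => //; first exact: measurable_funTS.
  by rewrite wi.
pose be := `|beta0|.
have mellin trig : trig = cos \/ trig = sin ->
    \int[G]_(y in posR R) (w y * y `^ alpha * trig (be * ln y)) = 0.
  move=> ctrig; apply: (weighted_mellin0 mpsi2 psi2M ial ctrig).
  rewrite -[RHS](mellin_parts mellin0 ctrig); congr (_ + _ * _).
  apply: eq_Rintegral => y; rewrite inE posRE => y0.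
  by rewrite psi2E.
(* For [beta0 = 0] the cosine condition would contradict [m0]. *)
have be0 : 0 < be.
  rewrite normr_gt0; apply/negP => /eqP b0; move: m0.
  rewrite (_ : \int[G]_(y in posR R) _ = 0) ?ltxx//.
  rewrite -[RHS](mellin cos (or_introl erefl)); apply: eq_Rintegral => y _.
  by rewrite /be b0 normr0 mul0r cos0 mulr1.
have [mu muE] := oscillating_law be alpha_gt0.
have mu_pos : mu (posR R) = 1%E.
  apply/eqP; rewrite eq_le probability_le1//=.
  have := muE 1 (lexx _); rewrite powR1 ln1 /osc mulr0 sin0 mulr0 addr0 mul1r => <-.
  apply: le_measure; rewrite ?inE//.
  by move=> x; rewrite posRE /= in_itv/= andbT; exact: lt_trans.
have [a1 a10 pa1] := phi1_pos; have [a2 a20 pa2] := phi1_neg.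
have [p [a [F [p0 F1 mean1 FE]]]] : exists (p a : R) (F : probability R R),
    [/\ 0 < p, F (posR R) = 1%E, (\int[F]_x (psi1 x)%:E = 0)%E &
    forall t, a <= t -> F `]t, +oo[%classic = (p%:E * mu `]t, +oo[%classic)%E].
  by apply: (centered_law mu_pos mpsi1 psi1M a10 _ a20); rewrite psi1E.
(* The tail of [mu] is explicit from 1 on, and that of [F] is proportional to it from [a] on. *)
pose A := Order.max 1 a.
have A1 : 1 <= A by rewrite le_max lexx.
have FA t : A <= t ->
    F `]t, +oo[%classic = (p * (t `^ (- alpha) * osc alpha be (ln t)))%:E.
  by rewrite ge_max => /andP[t1 at_]; rewrite FE// muE// EFinM.
have mean2 : (\int[distribution P Y]_y (psi2 y)%:E = 0)%E.
  by rewrite (eq_measure_integral G)// => B mB _; exact: YG.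
have [P' [P'fst P'snd P'joint]] :=
  sarmanov_coupling mpsi1 mpsi2 psi1M psi2M dens0 mean1 mean2.
(* On [R * T] the new variable is the first projection, and [Y] is carried over by the second. *)
pose Xm := isMeasurableFun.Build _ _ _ _ _ (@measurable_fst _ _ R T).
pose X : {mfun (R * T)%type >-> R} := HB.pack (@fst R T) Xm.
pose pim := isMeasurableFun.Build _ _ _ _ _ (@measurable_snd _ _ R T).
pose pi : {mfun (R * T)%type >-> T} := HB.pack (@snd R T) pim.
have lawX B : measurable B -> distribution P' X B = F B by exact: P'fst.
have lawY (B : set R) : measurable B ->
    distribution P' (Y \o pi : {mfun (R * T)%type >-> R}) B = G B.
  move=> mB; rewrite -YG//; apply: P'snd.
  by rewrite -[X in measurable X]setTI; exact: measurable_funPT.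
have joint C : measurable C -> P' [set z | C (z.1, Y z.2)] =
    (\int[F \x G]_(z in C) (1 + theta * psi1 z.1 * psi2 z.2)%:E)%E.
  move=> mC; rewrite P'joint//; apply: eq_measure_integral => B mB _.
  by apply: eq_product_measure => // D mD; exact: YG.
exists _, (R * T)%type, P', pi, X => Y'; split.
- exact: P'snd.
- move=> [r [_ rv]].
  apply: (osc_tail_not_regularly_varying alpha_gt0 be0 p0 A1 _ rv) => t At.
  rewrite /tail -[[set w | _]]/(fst @^-1` [set x | t < x]).
  rewrite (_ : [set x | t < x] = `]t, +oo[%classic).
    by rewrite P'fst// FA.
  by apply/seteqP; split => x /=; rewrite in_itv/= andbT.
- rewrite /bivariate_sarmanov; split.
  + by split; [exact: etrans (lawX _ mposR) F1|exact: etrans (lawY _ mposR) hG].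
  + split.
      apply: measurable_bounded_integrable => //.
      by rewrite ltey_eq fin_num_measure.
    rewrite (eq_measure_integral F); last by move=> B mB _; exact: lawX.
    rewrite -mean1 [LHS]integral_mkcond; apply: eq_integral => x _.
    by rewrite /psi1 restrict_EFin.
  + split.
      apply: measurable_bounded_integrable => //.
      by rewrite ltey_eq fin_num_measure.
    by rewrite (eq_measure_integral G)// => B mB _; exact: lawY.
  + move=> C mC; rewrite -[[set w | _]]/[set z | C (z.1, Y z.2)] joint//.
    have mE : measurable (posR R `*` posR R) by exact: measurableX.
    (* Both laws are carried by [posR R], so restricting to the quadrant changes no integral; there
       [psi1] and [psi2] coincide with [phi1] and [phi2]. *)
    rewrite -(ge0_integral_full_measure mC mE).
    * rewrite [RHS](@eq_measure_integral _ _ _ _ (F \x G)%E); last first.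
        by move=> B mB _; apply: eq_product_measure.
      apply: eq_integral => z; rewrite inE => -[_ [/=]].
      by rewrite !posRE => z1 z2; rewrite psi1E// psi2E.
    * rewrite -[LHS]/((F \x G)%E (posR R `*` posR R)).
      transitivity (F (posR R) * G (posR R))%E; first exact: product_measure1E.
      by rewrite F1 hG mule1.
    * have := measurable_sarmanov_density theta mpsi1 mpsi2.
      by move/measurable_EFinP.
    * by move=> z; rewrite lee_fin.
  + by move=> x y [/[!posRE] x0 _] [/[!posRE] y0 _]; exact: density_ge0.
- split => //.
  apply: (@regularly_varying_scaled _ _ _
    (p * \int[G]_(y in posR R) (w y * y `^ alpha))).
    by rewrite mulr_gt0.
  have tailE x : tail P' (X \* Y') x =
      \int[G]_(y in posR R) tail_kernel F psi1 psi2 theta x y.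
    rewrite /tail -[[set w | _]]/
      [set z | [set z : R * R | x < z.1 * z.2] (z.1, Y z.2)].
    rewrite joint; last exact: measurable_product_gt.
    by rewrite (product_tailE F mpsi1 mpsi2 psi1M psi2M dens0 x hG).
  under eq_cvg do rewrite tailE.
  apply: (scaled_product_tail_cvg mpsi1 mpsi2 psi1M psi2M dens0 psi1_lim
    alpha_gt0 p0 A1 FA ial); apply: mellin; by [left|right].
Unshelve. all: by end_near. Qed.
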